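(* Let $G$ be a finite, simple, connected, bipartite graph with $|V(G)|>1$ and bipartition $V(G)=A_G\cup B_G$ such that $|A_G|\le|B_G|$. Let $H$ be any finite, simple graph. If $$\frac{|A_G|+|B_G|}{|A_G|}\ \ge\ (\Delta(G)+\Delta(H)+1)\,\delta(H),$$ then $\gamma(G\square H)\ge\gamma(G)\gamma(H)$.
   Context: $\gamma(G)$ is the domination number of $G$, i.e. the minimum cardinality of a dominating set of $G$ (a set $D\subseteq V(G)$ such that every vertex is in $D$ or adjacent to a vertex of $D$). $\Delta(G)$ is the maximum degree of $G$. $G\square H$ is the Cartesian product of the graphs $G$ and $H$. The domination density is $\delta(G):=\gamma(G)/|V(G)|$ (so $\delta$ does not denote minimum degree). *)

(* Defs.v *)
From mathcomp Require Import all_boot all_order all_algebra.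

Set Implicit Arguments.
Unset Strict Implicit.
Unset Printing Implicit Defensive.

Import GRing.Theory Num.Theory.

Record sgraph := SGraph {
  vertex :> finType;
  adj : rel vertex;
  adj_sym : symmetric adj;
  adj_irr : irreflexive adj }.

Definition connected_graph (G : sgraph) : Prop :=
  forall x y : G, connect (@adj G) x y.

Definition bipartition (G : sgraph) (A B : {set G}) : Prop :=
  [/\ A :|: B = [set: G],
      [disjoint A & B],
      {in A &, forall x y, ~~ adj x y}
    & {in B &, forall x y, ~~ adj x y}].

Definition degree (G : sgraph) (x : G) : nat := #|[set y | adj x y]|.

(* Equal to 0 when G has no vertices. *)
Definition max_degree (G : sgraph) : nat := \max_(x : G) degree x.

Definition dominating (G : sgraph) (D : {set G}) : bool :=
  [forall x, (x \in D) || [exists y in D, adj x y]].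

Lemma dominatingT (G : sgraph) : dominating [set: G].
Proof. by apply/forallP => x; rewrite in_setT. Qed.

(* The seed [set: G] of the minimization is dominating (dominatingT), so this
   is a genuine minimum; see domination_numberP. *)
Definition domination_number (G : sgraph) : nat :=
  #|[arg min_(D < [set: G] | dominating D) #|D|]|.

Lemma domination_numberP (G : sgraph) :
  (exists2 D : {set G}, dominating D & #|D| = domination_number G) /\
  (forall D : {set G}, dominating D -> domination_number G <= #|D|).
Proof.
rewrite /domination_number.
by case: arg_minnP => [|D domD minD]; [exact: dominatingT | split=> //; exists D].
Qed.

(* For a graph with no vertices the quotient is 0 / 0 = 0. *)
Definition domination_density (G : sgraph) : rat :=
  ((domination_number G)%:R / #|G|%:R)%R.

Definition cart_adj (G H : sgraph) : rel (G * H) := fun u v =>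
  ((u.1 == v.1) && adj u.2 v.2) || (adj u.1 v.1 && (u.2 == v.2)).

Lemma cart_adj_sym (G H : sgraph) : symmetric (@cart_adj G H).
Proof.
move=> u v; rewrite /cart_adj [u.1 == _]eq_sym [u.2 == _]eq_sym.
by rewrite [adj u.1 _]adj_sym [adj u.2 _]adj_sym.
Qed.

Lemma cart_adj_irr (G H : sgraph) : irreflexive (@cart_adj G H).
Proof. by move=> u; rewrite /cart_adj !adj_irr andbF. Qed.

Definition cart_prod (G H : sgraph) : sgraph :=
  SGraph (@cart_adj_sym G H) (@cart_adj_irr G H).

(* Main.v *)
Require Import Defs.
From mathcomp Require Import all_boot all_order all_algebra.

Set Implicit Arguments.
Unset Strict Implicit.
Unset Printing Implicit Defensive.

Import GRing.Theory Num.Theory.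

(** The theorem is a counting argument.  A vertex of a graph [K] dominates at
    most [max_degree K + 1] vertices, so a dominating set of [K] has at least
    [#|K| / (max_degree K + 1)] elements ([leq_card_dominating]).  In the
    Cartesian product the degrees of the two coordinates add up
    ([max_degree_cart_prod]), hence, writing [d] for
    [max_degree G + max_degree H + 1],
      [#|G| * #|H| <= domination_number (cart_prod G H) * d].

    On the other side, [G] is connected with at least two vertices, so every
    vertex of [B] has a neighbour, necessarily in [A]: the part [A] dominates
    [G], and [domination_number G <= #|A|] ([dominating_part]).  With the
    denominators cleared, the density hypothesis says precisely that
      [d * domination_number H * #|A| <= #|G| * #|H|].
    Chaining the inequalities and cancelling [d] gives the result. *)

(** The closed neighbourhoods of the vertices of [D] cover the graph, and each
    has at most [(max_degree K).+1] elements. *)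
Lemma leq_card_dominating (K : sgraph) (D : {set K}) :
  dominating D -> #|K| <= #|D| * (max_degree K).+1.
Proof.
move=> /forallP domD; pose N (y : K) := y |: [set x | adj y x].
have cardN (y : K) : #|N y| <= (max_degree K).+1.
  rewrite cardsU1 -add1n leq_add ?leq_b1 //.
  exact: (leq_bigmax (F := @degree K)).
have /subset_leq_card : [set: K] \subset \bigcup_(y in D) N y.
  apply/subsetP => x _; case/orP: (domD x) => [xD | /exists_inP[y yD xy]].
    by apply/bigcupP; exists x; rewrite // setU11.
  by apply/bigcupP; exists y; rewrite // !inE adj_sym xy orbT.
rewrite cardsT => /leq_trans; apply.
rewrite -sum_nat_const; apply: leq_trans (leq_sum _ (fun y _ => cardN y)).
elim/big_rec2: _ => [|y n S _ leSn]; first by rewrite cards0.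
by apply: leq_trans (leq_add (leqnn _) leSn); rewrite cardsU leq_subr.
Qed.

Lemma max_degree_cart_prod (G H : sgraph) :
  max_degree (cart_prod G H) <= max_degree G + max_degree H.
Proof.
apply/bigmax_leqP => -[x y] _; rewrite /degree.
have -> : [set v | @adj (cart_prod G H) (x, y) v]
        = setX [set x] [set y' | adj y y'] :|: setX [set x' | adj x x'] [set y].
  by apply/setP => -[x' y']; rewrite !inE /= /cart_adj /= !(eq_sym _ x) !(eq_sym _ y).
rewrite cardsU; apply: leq_trans (leq_subr _ _) _.
rewrite !cardsX !cards1 mul1n muln1 addnC.
by apply: leq_add; [exact: (leq_bigmax (F := @degree G))
                   | exact: (leq_bigmax (F := @degree H))].
Qed.

(** The first edge of a path from [x] to any other vertex. *)
Lemma connected_exists_adj (G : sgraph) (x : G) :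
  connected_graph G -> 1 < #|G| -> exists y, adj x y.
Proof.
move=> connG; rewrite (cardD1 x) inE ltnS => /card_gt0P[z].
rewrite !inE andbT => zNx; case/connectP: (connG x z) => -[|y p] /=.
  by move=> _ zx; rewrite zx eqxx in zNx.
by case/andP=> xy _ _; exists y.
Qed.

(** A vertex outside [A] has a neighbour, which cannot also lie in the
    independent set [B]. *)
Lemma dominating_part (G : sgraph) (A B : {set G}) :
  connected_graph G -> 1 < #|G| -> bipartition A B -> dominating A.
Proof.
move=> connG G_gt1 [ABT _ _ indB]; apply/forallP => x.
have inAB z : (z \in A) || (z \in B) by rewrite -in_setU ABT inE.
case/orP: (inAB x) => [-> // | xB]; apply/orP; right.
have [y xy] := connected_exists_adj x connG G_gt1.
apply/exists_inP; exists y => //; case/orP: (inAB y) => // yB.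
by have := indB x y xB yB; rewrite xy.
Qed.

Lemma card_bipartition (G : sgraph) (A B : {set G}) :
  bipartition A B -> #|A| + #|B| = #|G|.
Proof.
by case=> ABT /disjoint_setI0 AB0 _ _; rewrite -cardsUI ABT AB0 cards0 cardsT addn0.
Qed.

Theorem lemma1 (G H : sgraph) (A B : {set G})
    (G_conn : connected_graph G)
    (G_gt1 : (1 < #|G|)%N)
    (AB_bip : bipartition A B)
    (leAB : (#|A| <= #|B|)%N)
    (hyp : ((max_degree G + max_degree H + 1)%N%:R * domination_density H
              <= (#|A| + #|B|)%N%:R / #|A|%:R :> rat)%R) :
  (domination_number G * domination_number H
     <= domination_number (cart_prod G H))%N.
Proof.
have leGA : domination_number G <= #|A|.
  exact: (domination_numberP G).2 (dominating_part G_conn G_gt1 AB_bip).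
have leH : domination_number H <= #|H|.
  by rewrite -cardsT; apply: (domination_numberP H).2; exact: dominatingT.
(* Clearing denominators needs [A] and [H] nonempty; in the other cases the
   left-hand side of the goal is 0. *)
have [A0 | A_gt0] := posnP #|A|; first by move: leGA; rewrite A0 leqn0 => /eqP->.
have [H0 | H_gt0] := posnP #|H|.
  by move: leH; rewrite H0 leqn0 => /eqP->; rewrite muln0.
rewrite (card_bipartition AB_bip) in hyp.
set d := max_degree G + max_degree H + 1 in hyp.
have hypN : d * domination_number H * #|A| <= #|G| * #|H|.
  move: hyp; rewrite /domination_density mulrA.
  rewrite ler_pdivrMr ?ltr0n // mulrAC ler_pdivlMr ?ltr0n //.
  by rewrite -!natrM ler_nat.
have [[D domD <-] _] := domination_numberP (cart_prod G H).
have d_gt0 : 0 < d by rewrite /d addn1.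
rewrite -(leq_pmul2l d_gt0).
apply: (@leq_trans (d * domination_number H * #|A|)).
  by rewrite -mulnA leq_pmul2l // mulnC leq_mul2l leGA orbT.
apply: leq_trans hypN _; rewrite -card_prod.
apply: leq_trans (leq_card_dominating domD) _.
by rewrite mulnC leq_mul2r /d addn1 ltnS max_degree_cart_prod orbT.
Qed.
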